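(* Let $a>0$, $\lambda>0$, $\gamma>0$, and consider the symmetric case $\lambda_0=\lambda_1=\lambda$, $\gamma_0=\gamma_1=\gamma$, $a_0=-a_1=a$. Let $$m(t)=\begin{cases}\dfrac{e^{-2\lambda t}-e^{-\gamma t}}{\gamma-2\lambda},&\gamma\ne2\lambda,\\[2mm] t\,e^{-\gamma t},&\gamma=2\lambda.\end{cases}$$ Then for all $t\ge0$ and $X(0)=x\in\mathbb R$, $$\mathbb E[X(t)\mid\varepsilon(0)=0]=xe^{-\gamma t}+a\,m(t),\qquad \mathbb E[X(t)\mid\varepsilon(0)=1]=xe^{-\gamma t}-a\,m(t),$$ and, conditionally on $\varepsilon(0)=i$ for either $i\in\{0,1\}$, the variance of $X(t)$ is $$\mathrm{Var}[X(t)]=a^2\begin{cases}\dfrac1{\gamma(\gamma+2\lambda)}-\dfrac{e^{-2\gamma t}}{(\gamma-2\lambda)^2}\left[e^{2(\gamma-2\lambda)t}-\dfrac{8\lambda}{\gamma+2\lambda}e^{(\gamma-2\lambda)t}+\dfrac{2\lambda}{\gamma}\right],&\gamma\ne2\lambda,\\[3mm] \dfrac1{2\gamma^2}\left[1-e^{-2\gamma t}\bigl(1+2\gamma t+2\gamma^2t^2\bigr)\right],&\gamma=2\lambda.\end{cases}$$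
   Context: Let $\varepsilon=\varepsilon(t)\in\{0,1\}$, $t\ge0$, be a time-homogeneous two-state Markov process with positive switching intensities $\lambda_0,\lambda_1$: $\mathbb P\{\varepsilon(t+dt)=i\mid\varepsilon(t)=i\}=1-\lambda_i\,dt+o(dt)$, $dt\to 0$. Let $a_0,a_1\in\mathbb R$ and $\gamma_0,\gamma_1>0$ with $a_0/\gamma_0>a_1/\gamma_1$. The Ornstein-Uhlenbeck process of bounded variation $X=X(t)$ is the path-continuous solution of $$dX(t)=\bigl(a_{\varepsilon(t)}-\gamma_{\varepsilon(t)}X(t)\bigr)\,dt,\quad t>0,\qquad X(0)=x.$$ *)

(* Defs.v *)
From HB Require Import structures.
From mathcomp Require Import all_boot all_order all_algebra.
From mathcomp Require Import all_classical all_reals all_analysis.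

Set Implicit Arguments.
Unset Strict Implicit.
Unset Printing Implicit Defensive.

Import Order.TTheory GRing.Theory Num.Theory.
Import numFieldNormedType.Exports.

Local Open Scope classical_set_scope.
Local Open Scope ring_scope.

Section conditioning.
Context d (T : measurableType d) (R : realType) (P : probability T R).

(* P(B | A); meaningful only when P(A) > 0. *)
Definition cprob (B A : set T) : R := fine (P (B `&` A)) / fine (P A).

(* The measure B |-> P(B | A), as a probability, so that 'E_ and 'V_ apply to
   it. When P(A) = 0, mnormalize falls back on P itself. *)
Definition cond_probability (A : set T) (mA : measurable A) : probability T R :=
  mnormalize (mrestr P mA) P.

Lemma cond_probabilityE (A : set T) (mA : measurable A) (B : set T) :
  measurable B -> (0 < P A)%E -> cond_probability mA B = (cprob B A)%:E.
Proof.
move=> mB A0; rewrite /cond_probability /= /mnormalize.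
have -> : (mrestr P mA : {measure set T -> \bar R}) setT = P A.
  by rewrite /= /mrestr setTI.
have PAf : P A \is a fin_num by exact: fin_num_measure.
rewrite gt_eqF //= lt_eqF -?ge0_fin_numE //= /mrestr.
by rewrite /cprob EFinM fineK // fin_num_measure //; exact: measurableI.
Qed.

End conditioning.

(* The states 0 and 1 are encoded as false and true. *)
Section two_state_markov.
Context d (T : measurableType d) (R : realType) (P : probability T R).
Implicit Types (eps : R -> {RV P >-> bool}) (lam : bool -> R).

Definition state_at eps (t : R) (i : bool) : set T := eps t @^-1` [set i].

Lemma measurable_state_at eps t i : measurable (state_at eps t i).
Proof. exact: measurable_funPTI. Qed.

(* The event {eps(u_1) = k_1, ..., eps(u_n) = k_n} for
   h = [:: (u_1, k_1); ...; (u_n, k_n)]. *)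
Definition history eps (h : seq (R * bool)) : set T :=
  [set w | all (fun uk => eps uk.1 w == uk.2) h].

(* Time runs over the nonnegative reals; the values of eps at negative times
   are irrelevant. Every condition on P(. | A) is required only when P(A) > 0,
   so that any initial law, in particular a deterministic one, is allowed. Right-continuity
   of the paths is the usual regularity of a jump process; it makes the paths
   measurable, hence the integral in ou_equation below meaningful. *)
Record two_state_markov eps lam : Prop := {
  markov_property : forall (h : seq (R * bool)) (s t : R) (i j : bool),
    0 <= s -> 0 <= t -> all (fun uk => (0 <= uk.1) && (uk.1 <= s)) h ->
    (0 < P (history eps h `&` state_at eps s i))%E ->
    cprob P (state_at eps (s + t) j) (history eps h `&` state_at eps s i) =
    cprob P (state_at eps (s + t) j) (state_at eps s i) ;
  markov_homogeneous : forall (s s' t : R) (i j : bool),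
    0 <= s -> 0 <= s' -> 0 <= t ->
    (0 < P (state_at eps s i))%E -> (0 < P (state_at eps s' i))%E ->
    cprob P (state_at eps (s + t) j) (state_at eps s i) =
    cprob P (state_at eps (s' + t) j) (state_at eps s' i) ;
  markov_intensity : forall (t : R) (i : bool),
    0 <= t -> (0 < P (state_at eps t i))%E ->
    (fun h : R => cprob P (state_at eps (t + h) i) (state_at eps t i)) =
    (fun h : R => 1 - lam i * h) +o_ (0^'+) (fun h : R => h) ;
  markov_right_continuous : forall (w : T) (t : R),
    0 <= t -> \forall s \near t^'+, eps s w = eps t w }.

(* Each path solves dX = (a_eps - gam_eps X) dt, X(0) = x, in integrated form:
   X is not differentiable at the switching times. *)
Record ou_bounded_variation eps (a gam : bool -> R) (x : R)
    (X : R -> {RV P >-> R}) : Prop := {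
  ou_continuous : forall w : T,
    {within `[0, +oo[, continuous (fun t : R => X t w)} ;
  ou_equation : forall (w : T) (t : R), 0 <= t ->
    X t w = x + \int[lebesgue_measure]_(s in `[0, t])
                  (a (eps s w) - gam (eps s w) * X s w) }.

End two_state_markov.

Definition ou_m (R : realType) (lambda gamma t : R) : R :=
  if gamma == 2 * lambda then t * expR (- gamma * t)
  else (expR (- 2 * lambda * t) - expR (- gamma * t)) / (gamma - 2 * lambda).

Definition ou_v (R : realType) (lambda gamma t : R) : R :=
  if gamma == 2 * lambda then
    (2 * gamma ^+ 2)^-1 *
    (1 - expR (- 2 * gamma * t) * (1 + 2 * gamma * t + 2 * gamma ^+ 2 * t ^+ 2))
  else
    (gamma * (gamma + 2 * lambda))^-1 -
    expR (- 2 * gamma * t) / (gamma - 2 * lambda) ^+ 2 *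
    (expR (2 * (gamma - 2 * lambda) * t)
     - 8 * lambda / (gamma + 2 * lambda) * expR ((gamma - 2 * lambda) * t)
     + 2 * lambda / gamma).

(* Main.v *)
Require Import Defs.
From mathcomp Require Import all_boot all_order all_algebra.
From mathcomp Require Import all_classical all_reals all_analysis.
From mathcomp Require Import measurable_realfun ring lra.

(** Write [sigma t] for the sign of the state at time [t]: 1 in state 0 and -1
    in state 1. The process [Y t = expR (gamma * t) * X t] starts at [x] and,
    since every path of the chain is right-continuous, has at each time the
    right derivative [a * expR (gamma * t) * sigma t]
    ([scaled_ou_right_derivative]). Bounded convergence carries right
    derivatives through expectations ([right_derivative_expectation]), and a
    left-continuous function is determined by its initial value and its right
    derivative ([right_derivative_mean_value]). Hence the mean of [Y t], the mean of
    [Y t * sigma t] and the mean of [Y t ^+ 2] are explicit primitives, found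
    in this order:
    - the right derivative of the mean of [Y] is a multiple of the mean of
      [sigma];
    - for a fixed [t], the mean of [Y u * sigma t], [u <= t], grows at a rate
      proportional to the mean of [sigma u * sigma t];
    - the mean of [Y ^+ 2] grows at a rate proportional to the mean of
      [Y * sigma].

    What remains is the law of the signs under P(. | eps(0) = i). In the
    symmetric case both states are left at the same rate [lambda], whatever
    the history, so the mean of [sigma v] on an event of the past is an
    exponential with rate [- 2 * lambda]. This gives the mean of [sigma v]
    ([expectation_sign]) and the correlation of [sigma s] and [sigma v]
    ([expectation_signM]). *)

Set Implicit Arguments.
Unset Strict Implicit.

Import Order.TTheory GRing.Theory Num.Theory.
Import numFieldNormedType.Exports.

Local Open Scope classical_set_scope.
Local Open Scope ring_scope.

(** * Right derivatives *)

Section right_derivative.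
Context {R : realType}.
Implicit Types (F G H : R -> R) (b c l k u v e : R).

Definition right_derivative F u l : Prop :=
  (F v - F u) / (v - u) @[v --> u^'+] --> l.

Lemma eq_cvg_at_right F G u l : (forall v, u < v -> F v = G v) ->
  F v @[v --> u^'+] --> l -> G v @[v --> u^'+] --> l.
Proof.
move=> FG; apply: cvg_trans; apply: near_eq_cvg; near=> v.
by rewrite FG//; near: v; exact: nbhs_right_gt.
Unshelve. all: by end_near. Qed.

(** The form without division: an error estimate for the affine approximation. *)
Lemma right_derivativeP F u l : right_derivative F u l <->
  forall e, 0 < e ->
    \forall v \near u^'+, `|F v - F u - l * (v - u)| <= e * (v - u).
Proof.
have key e v : u < v ->
    (`|l - (F v - F u) / (v - u)| <= e) =
    (`|F v - F u - l * (v - u)| <= e * (v - u)).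
  move=> uv; have vu : 0 < v - u by rewrite subr_gt0.
  have -> : F v - F u - l * (v - u) = ((F v - F u) / (v - u) - l) * (v - u).
    by rewrite mulrBl divfK ?gt_eqF.
  by rewrite distrC normrM (gtr0_norm vu) ler_pM2r.
split=> [/cvgrPdist_le h e e0|h]; [|apply/cvgrPdist_le => e e0].
- near=> v; rewrite -key; first by near: v; exact: h.
  by near: v; exact: nbhs_right_gt.
- near=> v; rewrite key; first by near: v; exact: h.
  by near: v; exact: nbhs_right_gt.
Unshelve. all: by end_near. Qed.

Lemma right_derivative_cvg F u l :
  right_derivative F u l -> F v @[v --> u^'+] --> F u.
Proof.
move=> Fl.
have vu : v - u @[v --> u^'+] --> (0 : R).
  rewrite -(subrr u); apply: cvgB; last exact: cvg_cst.
  by apply: cvg_at_right_filter; exact: cvg_id.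
rewrite -[X in _ --> X]addr0 -(mulr0 l).
apply: (@eq_cvg_at_right (fun v => F u + (F v - F u) / (v - u) * (v - u))).
  by move=> v uv; rewrite divfK ?subrKC// subr_eq0 gt_eqF.
by apply: cvgD; [exact: cvg_cst|exact: cvgM].
Qed.

Lemma right_derivativeM F G u l k :
  right_derivative F u l -> right_derivative G u k ->
  right_derivative (fun v => F v * G v) u (l * G u + F u * k).
Proof.
move=> Fl Gk.
apply: (@eq_cvg_at_right (fun v =>
    (F v - F u) / (v - u) * G v + F u * ((G v - G u) / (v - u)))).
  by move=> v _; ring.
apply: cvgD; apply: cvgM => //; last exact: cvg_cst.
exact: right_derivative_cvg Gk.
Qed.

Lemma right_derivativeB F G u l k :
  right_derivative F u l -> right_derivative G u k ->
  right_derivative (fun v => F v - G v) u (l - k).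
Proof.
move=> Fl Gk.
apply: (@eq_cvg_at_right (fun v =>
    (F v - F u) / (v - u) - (G v - G u) / (v - u))).
  by move=> v _; ring.
exact: cvgB.
Qed.

Lemma right_derivative_cst c u : right_derivative (fun=> c) u 0.
Proof.
rewrite /right_derivative subrr; under eq_fun do rewrite mul0r.
exact: cvg_cst.
Qed.

(** Caratheodory's slope function is the difference quotient off [u]. *)
Lemma is_derive_right_derivative F u l :
  is_derive u 1 F l -> right_derivative F u l.
Proof.
move=> /is_derive1_caratheodory[g [Fg gc <-]].
apply: (@eq_cvg_at_right g); last exact: cvg_at_right_filter.
by move=> v uv; rewrite Fg mulfK// subr_eq0 gt_eqF.
Qed.

(** The set of the [s] such that the bound with slope [K + e] holds on [b, s]
    contains its supremum, by continuity from the left, and the right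
    derivative at the supremum would let the bound go further; hence the
    supremum is [c]. *)
Lemma right_derivative_mean_value F b c K : b <= c ->
  (forall s, b < s <= c -> F v @[v --> s^'-] --> F s) ->
  (forall s, b <= s < c -> exists2 l, right_derivative F s l & `|l| <= K) ->
  `|F c - F b| <= K * (c - b).
Proof.
move=> bc Fleft Fright; apply/ler_addgt0Pr => e' e'0.
have [e e0 ee'] : exists2 e, 0 < e & e * (c - b) <= e'.
  exists (e' / (c - b + 1)); first by rewrite divr_gt0//; lra.
  rewrite mulrAC ler_pdivrMr; [nra|lra].
suff : `|F c - F b| <= (K + e) * (c - b) by move=> /le_trans; apply; lra.
pose good u := `|F u - F b| <= (K + e) * (u - b).
pose A := [set s | b <= s <= c /\ forall u, b <= u <= s -> good u].
have Ab : A b.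
  split=> [|u /andP[bu ub]]; first by rewrite lexx.
  have -> : u = b by apply/le_anti/andP.
  by rewrite /good !subrr normr0 mulr0.
have Aub : ubound A c by move=> s [/andP[]].
have hasA : has_sup A by split; [exists b|exists c].
set m := sup A.
have bm : b <= m by apply: ub_le_sup => //; exact: hasA.2.
have mc : m <= c by apply: ge_sup => //; exists b.
have goodlt u : b <= u < m -> good u.
  move=> /andP[bu um].
  have [s As us] := sup_gt hasA.1 um.
  by apply: As.2; rewrite bu ltW.
have K0 : b < c -> 0 <= K.
  move=> {}bc; have [|l _ lK] := Fright b; first by rewrite lexx.
  exact: le_trans lK.
(* Left continuity extends the bound to [m] itself. *)
have goodm : good m.
  move: bm; rewrite le_eqVlt => /predU1P[<-|bm].
    by apply: Ab.2; rewrite lexx.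
  rewrite /good leNgt; apply/negP => bad.
  set eta := `|F m - F b| - (K + e) * (m - b).
  have eta0 : 0 < eta by rewrite /eta; lra.
  have := Fleft m; rewrite bm mc => /(_ isT) /cvgrPdist_lt/(_ _ eta0) Fm.
  have : \forall u \near m^'-, False.
    near=> u.
    have um : u < m by near: u; exact: nbhs_left_lt.
    have bu : b < u by near: u; exact: nbhs_left_gt.
    have Fu : `|F m - F u| < eta by near: u.
    have : good u by apply: goodlt; rewrite um ltW.
    have := ler_normD (F m - F u) (F u - F b).
    rewrite addrA subrK.
    have := K0 (lt_le_trans bm mc).
    rewrite /good /eta in Fu *; nra.
  by move/filter_ex => [].
have Am : A m.
  split=> [|u /andP[bu]]; first by rewrite bm.
  by rewrite le_eqVlt => /predU1P[->//|um]; apply: goodlt; rewrite bu.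
move: mc; rewrite le_eqVlt => /predU1P[<-//|mc].
have [|l Fl lK] := Fright m; first by rewrite bm.
have := (right_derivativeP F m l).1 Fl _ e0 => Fm.
(* The bound persists to the right of [m], against the choice of [m]. *)
have goodright : \forall v \near m^'+, good v.
  near=> v.
  have mv : m < v by near: v; exact: nbhs_right_gt.
  have Fv : `|F v - F m - l * (v - m)| <= e * (v - m) by near: v.
  have h1 := ler_normD (F v - F m - l * (v - m)) (l * (v - m) + (F m - F b)).
  have h2 := ler_normD (l * (v - m)) (F m - F b).
  have h3 : `|l * (v - m)| <= K * (v - m).
    by rewrite normrM (@gtr0_norm _ (v - m)) ?subr_gt0// ler_pM2r ?subr_gt0.
  rewrite /good in goodm *.
  rewrite (_ : F v - F b = F v - F m - l * (v - m) + (l * (v - m) + (F m - F b)));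
    last by ring.
  nra.
move: goodright; rewrite near_withinE => -[r /= r0 rgood].
pose v := Num.min (m + r / 2) c.
have mv : m < v by rewrite lt_min mc andbT; lra.
have vr : v <= m + r / 2 by rewrite ge_min lexx.
suff /(ub_le_sup hasA.2) : A v by rewrite leNgt mv.
split=> [|u /andP[bu uv]].
  by rewrite (ltW (le_lt_trans bm mv)) ge_min lexx orbT.
have [um|mu] := leP u m; first by apply: Am.2; rewrite bu.
apply: rgood => //=; rewrite ltr_norml; apply/andP; split; lra.
Unshelve. all: by end_near. Qed.

(** Apply the mean value inequality with slope 0 to [F - H]. *)
Lemma right_derivative_primitive F H f b c : b <= c ->
  (forall s, b < s <= c -> F v @[v --> s^'-] --> F s) ->
  (forall s, b <= s < c -> right_derivative F s (f s)) ->
  (forall s : R, is_derive s 1 H (f s)) ->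
  F c - F b = H c - H b.
Proof.
move=> bc Fleft Fright Hf.
have : `|(F c - H c) - (F b - H b)| <= 0 * (c - b).
  apply: (@right_derivative_mean_value (fun v => F v - H v)) => // s sbc.
    apply: cvgB; first exact: Fleft.
    apply: cvg_at_left_filter; apply: differentiable_continuous.
    by apply/derivable1_diffP; exact: ex_derive.
  exists 0; last by rewrite normr0.
  rewrite -(subrr (f s)); apply: right_derivativeB; first exact: Fright.
  exact: is_derive_right_derivative.
rewrite mul0r normr_le0 subr_eq0 => /eqP; lra.
Qed.

End right_derivative.

(** * Expectations of families of bounded random variables *)

Section bounded_expectation.
Context d (T : measurableType d) (R : realType) (Q : probability T R).
Implicit Types (f g z : T -> R) (Z : R -> T -> R) (B K b c u v : R).

Lemma bounded_integrable f B : measurable_fun setT f ->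
  (forall w, `|f w| <= B) -> Q.-integrable setT (EFin \o f).
Proof.
move=> mf fB; apply: measurable_bounded_integrable => //.
  by rewrite (le_lt_trans (probability_le1 Q measurableT))// ltry.
exists B; split; first exact: num_real.
by move=> M BM w _ /=; rewrite (le_trans (fB w))// ltW.
Qed.

Lemma Rintegral_probability_cst B : \int[Q]_w B = B.
Proof. by rewrite Rintegral_cst//= probability_setT mulr1. Qed.

Lemma normr_Rintegral_le f B : measurable_fun setT f ->
  (forall w, `|f w| <= B) -> `|\int[Q]_w f w| <= B.
Proof.
move=> mf fB; have fi := bounded_integrable mf fB.
apply: le_trans (le_normr_Rintegral measurableT fi) _.
rewrite -[leRHS]Rintegral_probability_cst.
apply: le_Rintegral => //.
- apply: (@bounded_integrable _ B) => [|w]; last by rewrite normr_id.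
  exact: measurableT_comp.
- by apply: (@bounded_integrable _ `|B|) => // w.
Qed.

(** Bounded convergence, applied to the difference quotients at [u]. *)
Lemma right_derivative_expectation Z z u c B K : u < c ->
  (forall v, u <= v <= c -> measurable_fun setT (Z v)) ->
  (forall v w, u <= v <= c -> `|Z v w| <= B) ->
  (forall v w, u <= v <= c -> `|Z v w - Z u w| <= K * (v - u)) ->
  (forall w, right_derivative (Z^~ w) u (z w)) ->
  right_derivative (fun v => \int[Q]_w Z v w) u (\int[Q]_w z w).
Proof.
move=> uc mZ ZB ZK Zz.
have ? := ltW uc.
have uu : u <= u <= c by rewrite lexx ltW.
(* The bounds hold on [u, c] only, so the quotient is cut off after [c]. *)
pose g v w := if (u < v) && (v <= c) then (Z v w - Z u w) / (v - u) else 0.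
have K0 : 0 <= K.
  (* A probability space is not empty. *)
  have [w _] : [set: T] !=set0.
    apply/set0P/eqP => T0; have := probability_setT Q.
    by rewrite T0 measure0 => /eqP; rewrite eqe eq_sym oner_eq0.
  have cc : u <= c <= c by rewrite lexx ltW.
  by have := le_trans (normr_ge0 _) (ZK c w cc); rewrite pmulr_lge0 ?subr_gt0.
have Zi v : u <= v <= c -> Q.-integrable setT (EFin \o Z v).
  by move=> uvc; apply: bounded_integrable (mZ _ uvc) _ => w; exact: ZB.
have gK v w : `|g v w| <= K.
  rewrite /g; case: ifPn => [/andP[uv vc]|_]; last by rewrite normr0.
  rewrite normrM normfV (@gtr0_norm _ (v - u)) ?subr_gt0//.
  by rewrite ler_pdivrMr ?subr_gt0//; apply: ZK; rewrite ltW.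
have mg v : measurable_fun setT (g v).
  rewrite /g; have [/andP[uv vc]|_] := boolP (_ && _); last exact: measurable_cst.
  apply: measurable_funM; last exact: measurable_cst.
  by apply: measurable_funB; apply: mZ => //; rewrite ltW.
have gz w : g v w @[v --> u^'+] --> z w.
  apply: cvg_trans (Zz w); apply: near_eq_cvg; near=> v.
  rewrite /g ifT//; apply/andP; split; first by near: v; exact: nbhs_right_gt.
  by near: v; exact: nbhs_right_le.
have : \int[Q]_w g v w @[v --> u^'+] --> \int[Q]_w z w.
  apply/cvg_at_rightP => s [su s_cvg].
  have g_cvg w : g (s n) w @[n --> \oo] --> z w.
    exact: (iffLR (cvg_at_rightP _ _ _) (gz w)).
  have mz : measurable_fun setT z.
    by apply: (@measurable_fun_cvg _ _ _ _ (fun n => g (s n))) => // w _.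
  apply: fine_cvg; rewrite fineK; last first.
    apply: integrable_fin_num => //; apply: (@bounded_integrable _ K) => // w.
    by apply: (cvgr_to_le (cvg_norm (g_cvg w))); exact: nearW.
  apply: (@dominated_cvg _ _ _ _ _ _ _ _ (cst K%:E)) => //.
  - by move=> n; exact/measurable_EFinP.
  - by move=> w _; apply: cvg_EFin; [exact: nearW|exact: g_cvg].
  - by apply: (@bounded_integrable _ `|K|).
  - by move=> n w _; rewrite lee_fin.
apply: cvg_trans; apply: near_eq_cvg; near=> v.
have uv : u < v by near: v; exact: nbhs_right_gt.
have vc : v <= c by near: v; exact: nbhs_right_le.
have uvc : u <= v <= c by rewrite ltW.
rewrite /g uv vc/= RintegralZr//.
  by rewrite RintegralB//; exact: Zi.
apply: (@bounded_integrable _ (B + B)) => [|w].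
  by apply: measurable_funB; exact: mZ.
by rewrite (le_trans (ler_normB _ _))// lerD// ZB.
Unshelve. all: by end_near. Qed.

(** The mean of [Z] inherits the Lipschitz bound and, by bounded convergence,
    the right derivative [h]; it therefore grows like a primitive [H] of [h]. *)
Lemma expectation_evolution Z (z : R -> T -> R) (h H : R -> R) b c B K :
  b <= c ->
  (forall v, b <= v <= c -> measurable_fun setT (Z v)) ->
  (forall v w, b <= v <= c -> `|Z v w| <= B) ->
  (forall u v w, b <= u -> u <= v -> v <= c ->
    `|Z v w - Z u w| <= K * (v - u)) ->
  (forall u w, b <= u < c -> right_derivative (Z^~ w) u (z u w)) ->
  (forall u, b <= u < c -> \int[Q]_w z u w = h u) ->
  (forall s : R, is_derive s 1 H (h s)) ->
  \int[Q]_w Z c w = \int[Q]_w Z b w + (H c - H b).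
Proof.
move=> bc mZ ZB ZK Zz zh Hh.
suff : \int[Q]_w Z c w - \int[Q]_w Z b w = H c - H b by lra.
have Zi v : b <= v <= c -> Q.-integrable setT (EFin \o Z v).
  by move=> vbc; apply: bounded_integrable (mZ _ vbc) _ => w; exact: ZB.
apply: (@right_derivative_primitive _ (fun v => \int[Q]_w Z v w) H h) => //.
- move=> s /andP[bs sc]; apply/cvgrPdist_le => e e0.
  near=> v.
  have bv : b <= v by near: v; exact: nbhs_left_ge.
  have vs : v <= s by near: v; exact: nbhs_left_le.
  have vb : b <= v <= c by rewrite bv (le_trans vs).
  have sb : b <= s <= c by rewrite ltW.
  rewrite -RintegralB//; [|exact: Zi|exact: Zi].
  apply: (@le_trans _ _ (K * (s - v))).
    apply: normr_Rintegral_le; first by apply: measurable_funB; exact: mZ.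
    by move=> w; exact: ZK.
  have : s - e / (`|K| + 1) <= v.
    by near: v; apply: nbhs_left_ge; rewrite ltrBlDr ltrDl divr_gt0// ltr_wpDl.
  rewrite lerBlDr -lerBlDl ler_pdivlMr ?ltr_wpDl// => vs'.
  have := ler_norm K; nra.
- move=> u /andP[bu uc]; rewrite -zh ?bu//.
  apply: (@right_derivative_expectation _ _ _ c B K) => //.
  + by move=> v /andP[uv vc]; apply: mZ; rewrite vc (le_trans bu).
  + by move=> v w /andP[uv vc]; apply: ZB; rewrite vc (le_trans bu).
  + by move=> v w /andP[uv vc]; exact: ZK.
  + by move=> w; apply: Zz; rewrite bu.
Unshelve. all: by end_near. Qed.

End bounded_expectation.

(** * Regularity of the paths *)

Section paths.
Context {R : realType}.
Implicit Types (A : set R) (g F : R -> R) (c s t u v x : R).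

(** For a rational [q], the points [y < q] with [[y, q[] inside [A] form an
    interval; by assumption these countably many intervals cover [A]. *)
Lemma right_open_measurable A :
  (forall s, A s -> \forall y \near s^'+, A y) -> measurable A.
Proof.
move=> Aright.
pose I (q : rat) := [set y : R | y < ratr q /\
  forall z, y <= z < ratr q -> A z].
have -> : A = \bigcup_q I q.
  apply/seteqP; split=> [s As|s [q _ [sq]]]; last by apply; rewrite lexx.
  have := Aright s As; rewrite near_withinE => -[r /= r0 sr].
  have /rat_in_itvoo[q] : s < s + r by rewrite ltrDl.
  rewrite in_itv/= => /andP[sq qr]; exists q => //; split=> // z /andP[].
  rewrite le_eqVlt => /predU1P[<-//|sz] zq; apply: sr => //=.
  by rewrite distrC gtr0_norm ?subr_gt0//; lra.
apply: bigcupT_measurable_rat => q; apply: is_interval_measurable.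
move=> y1 y2 [y1q Ay1] [y2q _] y /andP[y1y yy2]; split.
  exact: le_lt_trans yy2 y2q.
by move=> z /andP[yz zq]; apply: Ay1; rewrite (le_trans y1y).
Qed.

(** Right continuity makes the preimage of [true] open to the right. *)
Lemma right_continuous_bool_measurable (e : R -> bool) (k : bool -> R) :
  (forall t, 0 <= t -> \forall s \near t^'+, e s = e t) ->
  measurable_fun (`[0, +oo[ : set R) (k \o e).
Proof.
move=> eright; apply: (@measurable_comp _ _ _ _ _ _ setT) => //.
apply: (@measurable_fun_bool _ _ _ _ true).
apply: right_open_measurable => s [/=]; rewrite in_itv/= andbT => s0 es.
near=> y; split => /=.
  by rewrite in_itv/= andbT (le_trans s0)//; near: y; exact: nbhs_right_ge.
by rewrite /preimage/= -es; near: y; exact: eright.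
Unshelve. all: by end_near. Qed.

(** The fundamental theorem of calculus for an integrand that is continuous
    from the right. *)
Lemma right_derivative_integral F g x :
  (forall t, 0 <= t -> F t = x + \int[lebesgue_measure]_(s in `[0, t]) g s) ->
  (forall t, 0 <= t -> lebesgue_measure.-integrable `[0, t] (EFin \o g)) ->
  (forall t, 0 <= t -> g s @[s --> t^'+] --> g t) ->
  forall t, 0 <= t -> right_derivative F t (g t).
Proof.
move=> Fg gi gright t t0; apply/right_derivativeP => e e0.
have /cvgrPdist_le/(_ e e0) := gright t t0.
rewrite near_withinE => -[r /= r0 tr].
near=> v.
have tv : t < v by near: v; exact: nbhs_right_gt.
have vr : v < t + r by near: v; apply: nbhs_right_lt; rewrite ltrDl.
have v0 : 0 <= v by rewrite (le_trans t0)// ltW.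
have gitv : lebesgue_measure.-integrable `]t, v] (EFin \o g).
  by apply: integrableS (gi v v0) => //; apply: subset_itvr; rewrite bnd_simp.
have mtv : measurable (`]t, v] : set R) by [].
have vt : lebesgue_measure (`]t, v] : set R) = (v - t)%:E.
  by rewrite lebesgue_measure_itv/= lte_fin tv.
have csti (k : R) : lebesgue_measure.-integrable `]t, v] (EFin \o (cst k)).
  apply: measurable_bounded_integrable => //; first by rewrite [ltLHS]vt ltry.
  by exists `|k|; split; [exact: num_real|move=> M kM y _ /=; exact: ltW].
have cstE (k : R) : k * (v - t) = \int[lebesgue_measure]_(s in `]t, v]) k.
  by rewrite Rintegral_cst// [X in fine X]vt.
have -> : F v - F t = \int[lebesgue_measure]_(s in `]t, v]) g s.
  rewrite !Fg// -(@Rintegral_itvB _ g (BLeft 0) (BRight v) t)//; first by ring.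
  - exact: gi.
  - by rewrite bnd_simp ltW.
rewrite !cstE -RintegralB//; last exact: csti.
have di : lebesgue_measure.-integrable `]t, v] (EFin \o (fun s => g s - g t)).
  by apply: (integrableB _ gitv (csti (g t))).
apply: (le_trans (le_normr_Rintegral _ di)) => //.
apply: le_Rintegral => //.
- by have := integrable_abse di.
- exact: csti.
- move=> s /=; rewrite in_itv/= => /andP[ts sv].
  rewrite distrC; apply: tr => //=.
  by rewrite distrC gtr0_norm ?subr_gt0//; lra.
Unshelve. all: by end_near. Qed.

End paths.

(** * The paths of the symmetric Ornstein-Uhlenbeck process *)

Definition state_sign {R : realType} (i : bool) : R := if i then - 1 else 1.

Lemma normr_state_sign {R : realType} i : `|state_sign i : R| = 1.
Proof. by case: i; rewrite /state_sign ?normrN normr1. Qed.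

Lemma measurable_state_sign d (T : measurableType d) (R : realType)
    (P : probability T R) (e : {RV P >-> bool}) :
  measurable_fun setT (fun w => state_sign (e w) : R).
Proof. by apply: (@measurableT_comp _ _ _ _ _ _ state_sign). Qed.

Lemma is_derive_expRM {R : realType} (k s : R) :
  is_derive s 1 (fun s : R => expR (k * s)) (k * expR (k * s)).
Proof.
have h : is_derive s (1 : R) (fun s : R => k * s) k.
  by apply: is_derive_eq; rewrite ?scaler0 ?add0r ?addr0 /GRing.scale/= mulr1.
by apply: is_derive_eq; rewrite /GRing.scale/= mulrC.
Qed.

Lemma expRM_left_continuous {R : realType} (k s : R) :
  expR (k * v) @[v --> s^'-] --> expR (k * s).
Proof.
apply: (@cvg_at_left_filter _ _ (fun v => expR (k * v))).
apply: (@differentiable_continuous _ _ _ s (fun v => expR (k * v))).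
by apply/derivable1_diffP; have [] := is_derive_expRM k s.
Qed.

Section ou_paths.
Context d (T : measurableType d) (R : realType) (P : probability T R).
Context (eps : R -> {RV P >-> bool}) (X : R -> {RV P >-> R}) (a gamma x : R).
Hypotheses (a_ge0 : 0 <= a) (gamma_ge0 : 0 <= gamma).
Hypothesis eps_right : forall (w : T) (t : R),
  0 <= t -> \forall s \near t^'+, eps s w = eps t w.
Hypothesis X_ou :
  ou_bounded_variation eps (fun i => if i then - a else a) (fun=> gamma) x X.
Implicit Types (w : T) (c s t u v : R).

Lemma ou_initial w : X 0 w = x.
Proof. by rewrite (ou_equation X_ou)// set_itv1 Rintegral_set1 addr0. Qed.

Let ou_itvcy w :
  {in `]0, +oo[, continuous (fun t : R => X t w)} /\
  X s w @[s --> 0^'+] --> X 0 w.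
Proof. by apply/continuous_within_itvcyP; exact: (ou_continuous X_ou). Qed.

Lemma ou_left_continuous w t : 0 < t -> X s w @[s --> t^'-] --> X t w.
Proof.
move=> t0; apply: cvg_at_left_filter.
have [+ _] := ou_itvcy w.
by apply; rewrite in_itv/= t0.
Qed.

Lemma ou_right_continuous w t : 0 <= t -> X s w @[s --> t^'+] --> X t w.
Proof.
have [Xc X0] := ou_itvcy w.
rewrite le_eqVlt => /predU1P[<-//|t0]; apply: cvg_at_right_filter.
by apply: Xc; rewrite in_itv/= t0.
Qed.

Let drift w s := (if eps s w then - a else a) - gamma * X s w.

Let drift_integrable w t : 0 <= t ->
  lebesgue_measure.-integrable `[0, t] (EFin \o drift w).
Proof.
move=> t0.
have sub : `[0, t] `<=` (`[0, +oo[ : set R).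
  by move=> s /=; rewrite !in_itv/= andbT => /andP[].
have fin : (lebesgue_measure (`[0%R, t] : set R) < +oo)%E.
  by rewrite lebesgue_measure_itv/=; case: ifP => _; rewrite ltry.
have i1 : lebesgue_measure.-integrable `[0, t]
    (EFin \o (fun s => if eps s w then - a else a)).
  apply: measurable_bounded_integrable => //.
    apply: measurable_funS sub _ => //.
    by apply: (@right_continuous_bool_measurable _ (eps^~ w)
      (fun i => if i then - a else a)) => s; exact: eps_right.
  exists a; split; first exact: num_real.
  move=> M aM s _ /=; apply: le_trans (ltW aM).
  by case: ifP => _; rewrite ?normrN ger0_norm.
have i2 : lebesgue_measure.-integrable `[0, t] (EFin \o (X^~ w)).
  apply: continuous_compact_integrable; first exact: segment_compact.
  apply: continuous_subspaceW sub _; exact: (ou_continuous X_ou).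
have := integrableB _ i1 (integrableZl _ gamma i2).
by apply.
Qed.

Lemma ou_right_derivative w t : 0 <= t ->
  right_derivative (X^~ w) t (a * state_sign (eps t w) - gamma * X t w).
Proof.
move=> t0.
rewrite (_ : _ - _ = drift w t); last first.
  by rewrite /drift /state_sign; case: ifP => _; rewrite ?mulrN mulr1.
apply: right_derivative_integral t t0.
- by move=> t t0; exact: (ou_equation X_ou).
- by move=> t t0; exact: drift_integrable.
- move=> t t0; rewrite /drift; apply: cvgB.
    apply: cvg_near_cst; near=> s; congr (if _ then _ else _).
    by near: s; exact: eps_right.
  by apply: cvgM; [exact: cvg_cst|exact: ou_right_continuous].
Unshelve. all: by end_near. Qed.

(** The integrating factor removes the linear term of the drift, so that the
    right derivative depends on the state only. *)
Definition scaled_ou t w : R := expR (gamma * t) * X t w.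

Lemma scaled_ou_initial w : scaled_ou 0 w = x.
Proof. by rewrite /scaled_ou mulr0 expR0 mul1r ou_initial. Qed.

Lemma scaled_ou_right_derivative w t : 0 <= t ->
  right_derivative (scaled_ou^~ w) t
    (a * expR (gamma * t) * state_sign (eps t w)).
Proof.
move=> t0.
have := right_derivativeM
  (is_derive_right_derivative (is_derive_expRM gamma t))
  (ou_right_derivative (w := w) t0).
congr right_derivative; ring.
Qed.

(** The bound is uniform in [w], as bounded convergence requires. *)
Lemma scaled_ou_lipschitz w u v c : 0 <= u -> u <= v -> v <= c ->
  `|scaled_ou v w - scaled_ou u w| <= a * expR (gamma * c) * (v - u).
Proof.
move=> u0 uv vc.
apply: (@right_derivative_mean_value _ (scaled_ou^~ w)) => // s.
  move=> /andP[us sv]; apply: cvgM; first exact: expRM_left_continuous.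
  by apply: ou_left_continuous; exact: le_lt_trans us.
move=> /andP[us sv]; have s0 := le_trans u0 us.
exists (a * expR (gamma * s) * state_sign (eps s w)).
  exact: scaled_ou_right_derivative.
have -> : `|a * expR (gamma * s) * state_sign (eps s w)| =
    a * expR (gamma * s).
  by rewrite normrM normr_state_sign mulr1 ger0_norm// mulr_ge0// expR_ge0.
rewrite ler_wpM2l// ler_expR ler_wpM2l//.
by rewrite (le_trans _ vc)// ltW.
Qed.

Lemma scaled_ou_bounded w t c : 0 <= t <= c ->
  `|scaled_ou t w| <= `|x| + a * expR (gamma * c) * c.
Proof.
move=> /andP[t0 tc].
rewrite -(subrK x (scaled_ou t w)) addrC (le_trans (ler_normD _ _))// lerD2l.
rewrite -{1}(scaled_ou_initial w).
rewrite (le_trans (scaled_ou_lipschitz w (lexx 0) t0 tc))//.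
by rewrite subr0 ler_wpM2l// mulr_ge0// expR_ge0.
Qed.

End ou_paths.

(** * Moments of the sign of the chain *)

Section chain.
Context d (T : measurableType d) (R : realType) (P : probability T R).
Context (eps : R -> {RV P >-> bool}) (lambda : R).
Hypothesis eps_markov : two_state_markov eps (fun=> lambda).
Implicit Types (hist : seq (R * bool)) (h s t u v : R) (k : bool).

Let past v : pred (R * bool) := fun uk => (0 <= uk.1) && (uk.1 <= v).

Let past_le s u hist : s <= u -> all (past s) hist -> all (past u) hist.
Proof.
move=> su; apply: sub_all => -[w k] /andP[w0 ws].
by rewrite /past w0 (le_trans ws).
Qed.

Lemma history_cons u k hist :
  history eps ((u, k) :: hist) = state_at eps u k `&` history eps hist.
Proof.
apply/seteqP; split=> w /=; first by move=> /andP[/eqP].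
by move=> [/eqP uk hw]; apply/andP.
Qed.

Lemma history_nil : history eps [::] = setT.
Proof. by apply/seteqP; split. Qed.

Lemma measurable_history hist : measurable (history eps hist).
Proof.
elim: hist => [|[u k] hist ih]; first by rewrite history_nil.
by rewrite history_cons; apply: measurableI => //; exact: measurable_state_at.
Qed.

Let measurable_hs hist v k : measurable (history eps hist `&` state_at eps v k).
Proof.
by apply: measurableI; [exact: measurable_history|exact: measurable_state_at].
Qed.

Lemma state_at_negb v k : state_at eps v (~~ k) = ~` state_at eps v k.
Proof.
by apply/seteqP; split=> w; rewrite /state_at /preimage/=; case: k; case: (eps v w).
Qed.

Lemma state_at_disjoint v k : state_at eps v k `&` state_at eps v (~~ k) = set0.
Proof. by rewrite state_at_negb setICr. Qed.

Lemma fine_split (Q : probability T R) (A : set T) v k : measurable A ->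
  fine (Q A) = fine (Q (A `&` state_at eps v k)) +
               fine (Q (A `&` state_at eps v (~~ k))).
Proof.
move=> mA.
have mk k' : measurable (A `&` state_at eps v k').
  by apply: measurableI => //; exact: measurable_state_at.
rewrite -fineD ?fin_num_measure// -measureU//.
  by rewrite -setIUr state_at_negb setUCr setIT.
by rewrite setIACA setIid state_at_disjoint setI0.
Qed.

(** Started from the state [k], the probability of being in the other state
    after a time [h] is the same at all times and for all histories. If [k] is never visited, any rate will
    do. *)
Lemma jump_probability k : exists2 rho : R -> R,
  rho h / h @[h --> 0^'+] --> lambda &
  forall hist v h, 0 <= v -> 0 <= h -> all (past v) hist ->
    fine (P (history eps hist `&` state_at eps v k `&`
             state_at eps (v + h) (~~ k))) =
    rho h * fine (P (history eps hist `&` state_at eps v k)).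
Proof.
have [[v0 [v00 v0k]]|never] :=
  pselect (exists v0, 0 <= v0 /\ (0 < P (state_at eps v0 k))%E); last first.
  have Pk0 (A B : set T) v : measurable (A `&` state_at eps v k `&` B) ->
      0 <= v -> P (A `&` state_at eps v k `&` B) = 0.
    move=> mAB v0; apply/eqP; rewrite eq_le measure_ge0 andbT leNgt.
    apply/negP => ABk; apply: never; exists v; split=> //.
    apply: lt_le_trans ABk _; apply: le_measure; rewrite ?inE//.
      exact: measurable_state_at.
    by move=> w [[]].
  (* Both sides vanish; the rate only has to have the right limit. *)
  exists (fun h => lambda * h).
    apply: (@eq_cvg_at_right _ (fun=> lambda)); last exact: cvg_cst.
    by move=> h h0; rewrite mulfK// gt_eqF.
  move=> hist v h v0 h0 _; rewrite -[in RHS](setIT (_ `&` _)) !Pk0 ?mulr0//.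
    by rewrite setIT.
  by apply: measurableI => //; exact: measurable_state_at.
pose stay h := cprob P (state_at eps (v0 + h) k) (state_at eps v0 k).
exists (fun h => 1 - stay h).
  apply/cvgrPdist_le => e e0.
  have /eqaddoP/(_ e e0) := markov_intensity eps_markov v00 v0k.
  move=> near_e; near=> h.
  have h0 : 0 < h by near: h; exact: nbhs_right_gt.
  have he : `|stay h - (1 - lambda * h)| <= e * `|h| by near: h.
  rewrite (_ : lambda - _ = (stay h - (1 - lambda * h)) / h); last first.
    by field; rewrite gt_eqF.
  by rewrite normrM normfV ler_pdivrMr ?normr_gt0 ?gt_eqF.
move=> hist v h v_ge0 h0 hist_past.
set B := history eps hist `&` state_at eps v k.
have mB : measurable B by exact: measurable_hs.
have [PB0|PB0] := eqVneq (P B) 0%E.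
  rewrite PB0 mulr0; apply/eqP; rewrite -eqe fineK ?fin_num_measure//; last first.
    by apply: measurableI => //; exact: measurable_state_at.
  rewrite eq_le measure_ge0 andbT -[leRHS]PB0; apply: le_measure; rewrite ?inE//.
  by apply: measurableI => //; exact: measurable_state_at.
have PB_gt0 : (0 < P B)%E by rewrite lt0e PB0 measure_ge0.
have stayE : stay h * fine (P B) = fine (P (B `&` state_at eps (v + h) k)).
  have Pk_gt0 : (0 < P (state_at eps v k))%E.
    apply: lt_le_trans PB_gt0 _; apply: le_measure; rewrite ?inE//.
      exact: measurable_state_at.
    by move=> w [].
  have -> : stay h = cprob P (state_at eps (v + h) k) B.
    rewrite (markov_property eps_markov k v_ge0 h0 hist_past PB_gt0).
    exact: (markov_homogeneous eps_markov k v00 v_ge0 h0 v0k Pk_gt0).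
  rewrite /cprob divfK ?fine_eq0 ?fin_num_measure//.
  by rewrite setIC.
rewrite mulrBl mul1r stayE (@fine_split P B (v + h) k)//.
by ring.
Unshelve. all: by end_near. Qed.

Section conditional.
Context (i : bool).
Hypothesis Pi_gt0 : (0 < P (state_at eps 0 i))%E.

Let Q : probability T R := cond_probability P (measurable_state_at eps 0 i).

Let Pi_neq0 : fine (P (state_at eps 0 i)) != 0.
Proof.
by rewrite fine_eq0 ?gt_eqF// fin_num_measure//; exact: measurable_state_at.
Qed.

Let QE (B : set T) : measurable B ->
  fine (Q B) = fine (P (B `&` state_at eps 0 i)) / fine (P (state_at eps 0 i)).
Proof. by move=> mB; rewrite cond_probabilityE. Qed.

Let Q_history hist v k (B : set T) : measurable B ->
  fine (Q (history eps hist `&` state_at eps v k `&` B)) =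
  fine (P (history eps ((0, i) :: hist) `&` state_at eps v k `&` B)) /
  fine (P (state_at eps 0 i)).
Proof.
move=> mB; rewrite QE; last by apply: measurableI.
by rewrite history_cons setIC !setIA.
Qed.

(** The mean, under P(. | eps(0) = i), of the sign at time [v] on the event
    [history eps hist]. *)
Let sign_mean hist v := fine (Q (history eps hist `&` state_at eps v false)) -
                        fine (Q (history eps hist `&` state_at eps v true)).

(** Leaving state 1 raises the sign by 2 and leaving state 0 lowers it by 2.
    The condition eps(0) = i is absorbed into the history. *)
Let sign_mean_increment : exists2 rho : bool -> R -> R,
  forall k, rho k h / h @[h --> 0^'+] --> lambda &
  forall hist v h, 0 <= v -> 0 <= h -> all (past v) hist ->
    sign_mean hist (v + h) - sign_mean hist v =
    2 * (rho true h * fine (Q (history eps hist `&` state_at eps v true))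
         - rho false h * fine (Q (history eps hist `&` state_at eps v false))).
Proof.
have [r1 r1_cvg r1E] := jump_probability true.
have [r0 r0_cvg r0E] := jump_probability false.
exists (fun k => if k then r1 else r0) => [[]//|hist v h v0 h0 hist_past].
have past0 : all (past v) ((0, i) :: hist) by rewrite /= /past/= lexx v0.
have ms u k : measurable (state_at eps u k) by exact: measurable_state_at.
have Q1 : fine (Q (history eps hist `&` state_at eps v true `&`
                   state_at eps (v + h) false)) =
    r1 h * fine (Q (history eps hist `&` state_at eps v true)).
  rewrite Q_history// r1E// -[in RHS](setIT (_ `&` _)) Q_history//.
  by rewrite setIT mulrA.
have Q0 : fine (Q (history eps hist `&` state_at eps v false `&`
                   state_at eps (v + h) true)) =
    r0 h * fine (Q (history eps hist `&` state_at eps v false)).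
  rewrite Q_history// r0E// -[in RHS](setIT (_ `&` _)) Q_history//.
  by rewrite setIT mulrA.
have A k := @fine_split Q (history eps hist `&` state_at eps v k) (v + h) true
  (measurable_hs _ _ _).
have B k := @fine_split Q (history eps hist `&` state_at eps (v + h) k) v true
  (measurable_hs _ _ _).
have C j k : history eps hist `&` state_at eps (v + h) j `&` state_at eps v k =
    history eps hist `&` state_at eps v k `&` state_at eps (v + h) j.
  by rewrite setIAC.
have := (A true, A false, B true, B false).
rewrite /sign_mean !C /= Q1 Q0 => -[[[A1 A0] B1] B0].
lra.
Qed.


(** The rates [rho k h / h] have the same limit [lambda] for both states, so
    the increment becomes a multiple of [sign_mean] itself. *)
Let sign_mean_right_derivative hist v : 0 <= v -> all (past v) hist ->
  right_derivative (sign_mean hist) v (- (2 * lambda) * sign_mean hist v).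
Proof.
move=> v0 hist_past; have [rho rho_cvg rhoE] := sign_mean_increment.
set q := fun k => fine (Q (history eps hist `&` state_at eps v k)).
have : 2 * (rho true h / h * q true - rho false h / h * q false)
    @[h --> 0^'+] --> 2 * (lambda * q true - lambda * q false).
  apply: cvgM; first exact: cvg_cst.
  by apply: cvgB; apply: cvgM => //; exact: cvg_cst.
rewrite (_ : 2 * _ = - (2 * lambda) * sign_mean hist v); last first.
  by rewrite /sign_mean /q; ring.
move=> /cvgrPdist_le lim; apply/cvgrPdist_le => e e0.
have := lim e e0; rewrite !near_withinE => -[r /= r0 near_r].
exists r => //= u uv_r vu.
have uv0 : 0 < u - v by rewrite subr_gt0.
have := near_r (u - v); rewrite /= sub0r opprB => /(_ uv_r uv0).
congr (`|_ - _| <= _).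
have := rhoE hist v (u - v) v0 (ltW uv0) hist_past.
rewrite subrKC => ->; rewrite /q; ring.
Qed.

(** The jump probabilities depend on the elapsed time only, so the increment
    from [u] to [v] is small as [u] tends to [v] from the left. *)
Let sign_mean_left_continuous hist s v : 0 <= s -> s < v ->
  all (past s) hist -> sign_mean hist u @[u --> v^'-] --> sign_mean hist v.
Proof.
move=> s0 sv hist_past; have [rho rho_cvg rhoE] := sign_mean_increment.
have rho0 k : rho k h @[h --> 0^'+] --> (0 : R).
  rewrite -[X in _ --> X](mulr0 lambda).
  apply: (@eq_cvg_at_right _ (fun h => rho k h / h * h)).
    by move=> h h0; rewrite divfK// gt_eqF.
  by apply: cvgM => //; apply: cvg_at_right_filter; exact: cvg_id.
have q_le1 u k : `|fine (Q (history eps hist `&` state_at eps u k))| <= 1.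
  rewrite ger0_norm ?fine_ge0// -lee_fin fineK ?fin_num_measure//.
  exact: probability_le1.
apply/cvgrPdist_le => e e0.
have e4 : 0 < e / 4 by lra.
have rho_small k : exists2 r, 0 < r & forall h, 0 < h < r -> `|rho k h| <= e / 4.
  have /cvgrPdist_le/(_ _ e4) := rho0 k; rewrite near_withinE => -[r /= r0 near_r].
  exists r => // h /andP[h0 hr]; rewrite -normrN -sub0r; apply: near_r => //=.
  by rewrite sub0r normrN gtr0_norm.
have [r0 r00 near_r0] := rho_small false; have [r1 r10 near_r1] := rho_small true.
near=> u.
have su : s <= u.
  by near: u; exact: nbhs_left_ge.
have uv : u < v by near: u; exact: nbhs_left_lt.
have vu0 : 0 < v - u by rewrite subr_gt0.
have ur0 : v - r0 < u by near: u; apply: nbhs_left_gt; lra.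
have ur1 : v - r1 < u by near: u; apply: nbhs_left_gt; lra.
have u_past := past_le su hist_past.
have := rhoE hist u (v - u) (le_trans s0 su) (ltW vu0) u_past.
rewrite subrKC => ->.
have small k : `|rho k (v - u)| <= e / 4.
  by case: k; [apply: near_r1|apply: near_r0]; rewrite vu0; lra.
rewrite normrM ger0_norm// (le_trans (ler_wpM2l _ (ler_normB _ _)))//.
have prod k : `|rho k (v - u) * fine (Q (history eps hist `&` state_at eps u k))|
    <= e / 4.
  by rewrite normrM -[leRHS]mulr1 ler_pM.
have := prod true; have := prod false; lra.
Unshelve. all: by end_near. Qed.

(** By the integrating factor [expR (2 * lambda * v)], the linear equation of
    [sign_mean_right_derivative] has a single solution. *)
Let sign_mean_decay hist s v : 0 <= s -> s <= v -> all (past s) hist ->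
  sign_mean hist v = expR (- (2 * lambda) * (v - s)) * sign_mean hist s.
Proof.
move=> s0 sv hist_past.
pose F u := expR (2 * lambda * u) * sign_mean hist u.
have FE : F v - F s = 0 - 0.
  apply: (@right_derivative_primitive _ F (fun=> 0) (fun=> 0)) => // u.
    move=> /andP[su uv]; apply: cvgM.
      exact: expRM_left_continuous.
    exact: sign_mean_left_continuous su hist_past.
  move=> /andP[su uv].
  have u_past := past_le su hist_past.
  have := right_derivativeM
    (is_derive_right_derivative (is_derive_expRM (2 * lambda) u))
    (sign_mean_right_derivative (le_trans s0 su) u_past).
  congr right_derivative; ring.
have {FE} : F v = F s by lra.
rewrite /F => FE; apply: (@mulfI _ (expR (2 * lambda * v))).
  by rewrite gt_eqF// expR_gt0.
by rewrite FE mulrA -expRD; congr (expR _ * _); ring.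
Qed.

Let sign_mean_nil0 : sign_mean [::] 0 = state_sign i.
Proof.
have Q_i : fine (Q (state_at eps 0 i)) = 1.
  by rewrite QE ?setIid ?divff//; exact: measurable_state_at.
have Q_ni : fine (Q (state_at eps 0 (~~ i))) = 0.
  rewrite QE; last exact: measurable_state_at.
  by rewrite setIC state_at_disjoint measure0 mul0r.
rewrite /sign_mean !history_nil !setTI /state_sign.
by move: Q_i Q_ni; case: i => /= -> ->; rewrite ?sub0r ?subr0.
Qed.

Let Rintegral_indicator (A : set T) : measurable A ->
  \int[Q]_w (\1_A w : R) = fine (Q A).
Proof. by move=> mA; rewrite /Rintegral integral_indic// setIT. Qed.

Let indicator_integrable (A : set T) : measurable A ->
  Q.-integrable setT (EFin \o (\1_A : T -> R)).
Proof.
move=> mA; apply: (@bounded_integrable _ _ _ _ _ 1) => //.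
by move=> w; rewrite indicE; case: (_ \in _); rewrite ?normr1 ?normr0.
Qed.

Let expectation_history_sign hist v :
  \int[Q]_w (\1_(history eps hist) w * state_sign (eps v w)) = sign_mean hist v.
Proof.
rewrite /sign_mean -!Rintegral_indicator// -RintegralB//;
  [|exact: indicator_integrable|exact: indicator_integrable].
apply: eq_Rintegral => w _; rewrite !indicI /=.
rewrite -mulrBr; congr (_ * _).
rewrite !indicE /state_sign; case e : (eps v w).
  rewrite memNset ?mem_set ?sub0r//= /state_at/preimage/= e//.
by rewrite mem_set ?memNset ?subr0//= /state_at/preimage/= e.
Qed.

Lemma expectation_sign v : 0 <= v ->
  \int[Q]_w state_sign (eps v w) = expR (- (2 * lambda) * v) * state_sign i.
Proof.
move=> v0; rewrite -sign_mean_nil0 -{2}(subr0 v) -sign_mean_decay//.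
rewrite -expectation_history_sign; apply: eq_Rintegral => w _.
by rewrite history_nil indicT mul1r.
Qed.

(** Split according to the state at time [s] and let each part decay from
    [s] on. *)
Lemma expectation_signM s v : 0 <= s -> s <= v ->
  \int[Q]_w (state_sign (eps v w) * state_sign (eps s w)) =
  expR (- (2 * lambda) * (v - s)).
Proof.
move=> s0 sv.
have ms k : measurable (state_at eps s k) by exact: measurable_state_at.
pose Z k w : R := \1_(history eps [:: (s, k)]) w * state_sign (eps v w).
have Zi k : Q.-integrable setT (EFin \o Z k).
  apply: (@bounded_integrable _ _ _ _ _ 1).
    apply: measurable_funM; last exact: measurable_state_sign.
    by apply: measurable_indic; exact: measurable_history.
  move=> w; rewrite normrM normr_state_sign mulr1 indicE.
  by case: (_ \in _); rewrite ?normr1 ?normr0.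
transitivity (\int[Q]_w (Z false w - Z true w)).
  apply: eq_Rintegral => w _; rewrite /Z !history_cons history_nil !setIT.
  rewrite -mulrBl mulrC; congr (_ * _).
  rewrite !indicE /state_sign; case e : (eps s w).
    rewrite memNset ?mem_set ?sub0r//= /state_at/preimage/= e//.
  by rewrite mem_set ?memNset ?subr0//= /state_at/preimage/= e.
rewrite RintegralB// !expectation_history_sign.
have past_s k : all (past s) [:: (s, k)] by rewrite /= /past/= s0 lexx.
rewrite !(sign_mean_decay s0 sv)// -mulrBr -[RHS]mulr1; congr (_ * _).
rewrite /sign_mean !history_cons history_nil !setIT.
rewrite !setIid (state_at_disjoint s false) setIC (state_at_disjoint s false).
rewrite measure0.
have := @fine_split Q setT s false measurableT.
by rewrite probability_setT !setTI/=; lra.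
Qed.

End conditional.
End chain.

(** * Moments of the process *)

Section growth.
Context {R : realType} (lambda gamma : R).

(** The primitive of [expR ((gamma - 2 * lambda) * t)] that vanishes at 0
    (see [is_derive_growth]); this is how [ou_m] enters. *)
Definition growth (t : R) : R := expR (gamma * t) * ou_m lambda gamma t.

Lemma growthE t : growth t =
  if gamma == 2 * lambda then t
  else (expR ((gamma - 2 * lambda) * t) - 1) / (gamma - 2 * lambda).
Proof.
rewrite /growth /ou_m; case: ifP => _.
  by rewrite mulrCA -expRD mulNr subrr expR0 mulr1.
rewrite mulrA mulrBr -!expRD; congr ((expR _ - _) / _); first by ring.
by rewrite mulNr subrr expR0.
Qed.

Lemma growth0 : growth 0 = 0.
Proof. by rewrite growthE mulr0 expR0 subrr mul0r if_same. Qed.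

Lemma is_derive_growth (t : R) :
  is_derive t 1 growth (expR ((gamma - 2 * lambda) * t)).
Proof.
rewrite (funext growthE); have [->|gl] := eqVneq gamma (2 * lambda).
  by rewrite subrr mul0r expR0; exact: is_derive_id.
have dl : gamma - 2 * lambda != 0 by rewrite subr_eq0.
have h := is_derive_expRM (gamma - 2 * lambda) t.
rewrite [X in is_derive _ _ X _](_ : _ =
  (fun s => (gamma - 2 * lambda)^-1 *: (expR ((gamma - 2 * lambda) * s) - 1))).
  by apply: is_derive_eq; rewrite subr0 /GRing.scale/= mulKf.
by apply/funext => s; rewrite /GRing.scale/= mulrC.
Qed.

End growth.

Section moments.
Context d (T : measurableType d) (R : realType) (P : probability T R).
Context (eps : R -> {RV P >-> bool}) (X : R -> {RV P >-> R}).
Context (a lambda gamma x : R).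
Hypotheses (a_gt0 : 0 < a) (lambda_gt0 : 0 < lambda) (gamma_gt0 : 0 < gamma).
Hypothesis eps_markov : two_state_markov eps (fun=> lambda).
Hypothesis X_ou :
  ou_bounded_variation eps (fun i => if i then - a else a) (fun=> gamma) x X.
Context (i : bool).
Hypothesis Pi_gt0 : (0 < P (state_at eps 0 i))%E.
Implicit Types (t u v : R).

Let Q : probability T R := cond_probability P (measurable_state_at eps 0 i).
Let Y := scaled_ou X gamma.
Let sg v w : R := state_sign (eps v w).
Let a_ge0 := ltW a_gt0.
Let gamma_ge0 := ltW gamma_gt0.
Let eps_right := markov_right_continuous eps_markov.
Let bound t : R := `|x| + a * expR (gamma * t) * t.
Let slope t : R := a * expR (gamma * t).

Let Y0 w : Y 0 w = x. Proof. exact: (scaled_ou_initial X_ou). Qed.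

Let Y_bounded t v w : 0 <= v <= t -> `|Y v w| <= bound t.
Proof. exact: (scaled_ou_bounded a_ge0 gamma_ge0 eps_right X_ou). Qed.

Let Y_lipschitz t u v w : 0 <= u -> u <= v -> v <= t ->
  `|Y v w - Y u w| <= slope t * (v - u).
Proof. exact: (scaled_ou_lipschitz a_ge0 gamma_ge0 eps_right X_ou). Qed.

Let Y_right_derivative u w : 0 <= u ->
  right_derivative (Y^~ w) u (a * expR (gamma * u) * sg u w).
Proof. exact: (scaled_ou_right_derivative a_ge0 eps_right X_ou). Qed.

Let mY v : measurable_fun setT (Y v).
Proof. by apply: measurable_funM. Qed.

Let msg v : measurable_fun setT (sg v).
Proof. exact: measurable_state_sign. Qed.

Let sg_norm v w : `|sg v w| = 1. Proof. exact: normr_state_sign. Qed.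

Let expR_split u :
  expR ((gamma - 2 * lambda) * u) = expR (gamma * u) * expR (- (2 * lambda) * u).
Proof. by rewrite -expRD; congr expR; ring. Qed.

Let integrable_sg v : Q.-integrable setT (EFin \o sg v).
Proof. by apply: (@bounded_integrable _ _ _ _ _ 1) => // w; rewrite sg_norm. Qed.

Let integrable_sgM u v : Q.-integrable setT (EFin \o (fun w => sg v w * sg u w)).
Proof.
apply: (@bounded_integrable _ _ _ _ _ 1) => [|w]; first exact: measurable_funM.
by rewrite normrM !sg_norm mulr1.
Qed.

Let integrable_Ysg t : 0 <= t ->
  Q.-integrable setT (EFin \o (fun w => Y t w * sg t w)).
Proof.
move=> t0; apply: (@bounded_integrable _ _ _ _ _ (bound t)) => [|w].
  exact: measurable_funM.
by rewrite normrM sg_norm mulr1 Y_bounded// t0 lexx.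
Qed.

Lemma mean_scaled t : 0 <= t ->
  \int[Q]_w Y t w = x + a * state_sign i * growth lambda gamma t.
Proof.
move=> t0.
have dH s : is_derive s (1 : R) (fun u => a * state_sign i * growth lambda gamma u)
    (a * state_sign i * expR ((gamma - 2 * lambda) * s)).
  have h := is_derive_growth lambda gamma s.
  by apply: is_derive_eq.
rewrite (@expectation_evolution _ _ _ Q Y
  (fun u w => a * expR (gamma * u) * sg u w)
  (fun u => a * state_sign i * expR ((gamma - 2 * lambda) * u))
  (fun u => a * state_sign i * growth lambda gamma u)
  0 t (bound t) (slope t) _ _ _ _ _ _ dH)//.
- under eq_Rintegral do rewrite Y0.
  by rewrite Rintegral_probability_cst growth0 mulr0 subr0.
- by move=> *; exact: Y_bounded.
- by move=> *; exact: Y_lipschitz.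
- by move=> u w /andP[u0 _]; exact: Y_right_derivative.
- move=> u /andP[u0 _]; rewrite RintegralZl// (expectation_sign eps_markov)//.
  by rewrite expR_split; ring.
Qed.

(** For the product with the sign at time [t] the evolution is followed on
    [0, t] with that sign fixed, so that only the correlation of two signs
    enters. *)
Lemma mean_scaled_sign t : 0 <= t ->
  \int[Q]_w (Y t w * sg t w) = expR (- (2 * lambda) * t) *
    (x * state_sign i +
     a * (expR ((gamma + 2 * lambda) * t) - 1) / (gamma + 2 * lambda)).
Proof.
move=> t0.
have gl0 : gamma + 2 * lambda != 0 by rewrite gt_eqF// addr_gt0// mulr_gt0.
pose k := a * expR (- (2 * lambda) * t).
have dH s : is_derive s (1 : R)
    (fun u => k / (gamma + 2 * lambda) * expR ((gamma + 2 * lambda) * u))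
    (k * expR ((gamma + 2 * lambda) * s)).
  have h := is_derive_expRM (gamma + 2 * lambda) s.
  by apply: is_derive_eq; rewrite /GRing.scale/=; field.
rewrite (@expectation_evolution _ _ _ Q (fun u w => Y u w * sg t w)
  (fun u w => a * expR (gamma * u) * (sg t w * sg u w))
  (fun u => k * expR ((gamma + 2 * lambda) * u))
  (fun u => k / (gamma + 2 * lambda) * expR ((gamma + 2 * lambda) * u))
  0 t (bound t) (slope t) _ _ _ _ _ _ dH)//.
- under eq_Rintegral do rewrite Y0.
  rewrite RintegralZl// (expectation_sign eps_markov)// mulr0 expR0 /k.
  by field.
- by move=> v _; exact: measurable_funM.
- by move=> v w v0; rewrite normrM sg_norm mulr1 Y_bounded.
- by move=> u v w u0 uv vt; rewrite -mulrBl normrM sg_norm mulr1 Y_lipschitz.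
- move=> u w /andP[u0 _].
  have := right_derivativeM (Y_right_derivative (w := w) u0)
    (right_derivative_cst (sg t w) u).
  congr right_derivative; ring.
- move=> u /andP[u0 /ltW ut].
  rewrite RintegralZl// (expectation_signM eps_markov)// /k -!mulrA -!expRD.
  congr (_ * expR _); ring.
Qed.

(** The right derivative of [Y ^+ 2] is [2 * a * expR (gamma * u)] times
    [Y * sg], whose mean is [mean_scaled_sign]. *)
Lemma mean_scaled_square t : 0 <= t ->
  \int[Q]_w (Y t w * Y t w) = x ^+ 2
    + 2 * a * x * state_sign i * growth lambda gamma t
    + 2 * a ^+ 2 / (gamma + 2 * lambda) *
      ((expR (2 * gamma * t) - 1) / (2 * gamma) - growth lambda gamma t).
Proof.
move=> t0.
have gl0 : gamma + 2 * lambda != 0 by rewrite gt_eqF// addr_gt0// mulr_gt0.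
have g0 : gamma != 0 by rewrite gt_eqF.
pose k := 2 * a ^+ 2 / (gamma + 2 * lambda).
have dH s : is_derive s (1 : R)
    (fun u => 2 * a * x * state_sign i * growth lambda gamma u
      + k * (expR (2 * gamma * u) / (2 * gamma) - growth lambda gamma u))
    (2 * a * x * state_sign i * expR ((gamma - 2 * lambda) * s)
      + k * (expR (2 * gamma * s) - expR ((gamma - 2 * lambda) * s))).
  have h1 := is_derive_growth lambda gamma s.
  have h2 := is_derive_expRM (2 * gamma) s.
  by apply: is_derive_eq; rewrite /GRing.scale/=; field.
rewrite (@expectation_evolution _ _ _ Q (fun u w => Y u w * Y u w)
  (fun u w => 2 * a * expR (gamma * u) * (Y u w * sg u w))
  (fun u => 2 * a * x * state_sign i * expR ((gamma - 2 * lambda) * u)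
    + k * (expR (2 * gamma * u) - expR ((gamma - 2 * lambda) * u)))
  (fun u => 2 * a * x * state_sign i * growth lambda gamma u
    + k * (expR (2 * gamma * u) / (2 * gamma) - growth lambda gamma u))
  0 t (bound t * bound t) (2 * bound t * slope t) _ _ _ _ _ _ dH)//.
- under eq_Rintegral do rewrite !Y0.
  rewrite Rintegral_probability_cst growth0 !mulr0 expR0 /k.
  by field; rewrite g0.
- by move=> v _; exact: measurable_funM.
- by move=> v w v0; rewrite normrM ler_pM// Y_bounded.
- move=> u v w u0 uv vt.
  have -> : Y v w * Y v w - Y u w * Y u w = (Y v w + Y u w) * (Y v w - Y u w) by ring.
  rewrite normrM -mulrA ler_pM//; last exact: Y_lipschitz.
  have uB : 0 <= u <= t by rewrite u0 (le_trans uv).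
  have vB : 0 <= v <= t by rewrite vt (le_trans u0).
  by rewrite (le_trans (ler_normD _ _))// mulr2n mulrDl mul1r lerD// Y_bounded.
- move=> u w /andP[u0 _].
  have Yd := Y_right_derivative (w := w) u0.
  have := right_derivativeM Yd Yd.
  congr right_derivative; ring.
- move=> u /andP[u0 _].
  rewrite RintegralZl//; last exact: integrable_Ysg.
  rewrite mean_scaled_sign//.
  rewrite expR_split.
  have -> : expR (2 * gamma * u) =
      expR (gamma * u) * expR (- (2 * lambda) * u) * expR ((gamma + 2 * lambda) * u).
    by rewrite -!expRD; congr expR; ring.
  by rewrite /k; field.
Qed.

Let XE t w : X t w = expR (- gamma * t) * Y t w.
Proof. by rewrite /Y /scaled_ou mulrA -expRD mulNr addNr expR0 mul1r. Qed.

Let integrable_Y t : 0 <= t -> Q.-integrable setT (EFin \o Y t).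
Proof.
move=> t0; apply: (@bounded_integrable _ _ _ _ _ (bound t)) => // w.
by rewrite Y_bounded// t0 lexx.
Qed.

Let integrable_YY t : 0 <= t ->
  Q.-integrable setT (EFin \o (fun w => Y t w * Y t w)).
Proof.
move=> t0; apply: (@bounded_integrable _ _ _ _ _ (bound t * bound t)) => [|w].
  exact: measurable_funM.
by rewrite normrM ler_pM// Y_bounded// t0 lexx.
Qed.

Let mean_unscaled t : expR (- gamma * t) *
    (x + a * state_sign i * growth lambda gamma t) =
  x * expR (- gamma * t) + a * state_sign i * ou_m lambda gamma t.
Proof.
have h : expR (- gamma * t) * expR (gamma * t) = 1.
  by rewrite -expRD mulNr addNr expR0.
by rewrite /growth; ring: h.
Qed.

Lemma expectation_ou t : 0 <= t -> ('E_Q[X t] =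
  (x * expR (- gamma * t) + a * state_sign i * ou_m lambda gamma t)%:E)%E.
Proof.
move=> t0; rewrite unlock.
under eq_integral do rewrite XE EFinM.
rewrite integralZl//; last exact: integrable_Y.
rewrite -[X in (_ * X)%E]fineK; last exact: integrable_fin_num (integrable_Y t0).
by rewrite -EFinM [fine _](mean_scaled t0) mean_unscaled.
Qed.

(** The variance is [expR (- gamma * t) ^+ 2] times that of [Y t], in which the
    terms containing [x] cancel. *)
Lemma variance_ou t : 0 <= t ->
  ('V_Q[X t] = (a ^+ 2 * ou_v lambda gamma t)%:E)%E.
Proof.
move=> t0.
have iY := integrable_Y t0; have iYY := integrable_YY t0.
pose M := \int[Q]_w Y t w.
have mX : fine ('E_Q[X t])%E = expR (- gamma * t) * M.
  by rewrite expectation_ou//= /M mean_scaled// mean_unscaled.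
rewrite /variance covariance.unlock mX expectation.unlock.
pose Z w := Y t w * Y t w - 2 * M * Y t w + M ^+ 2.
transitivity (\int[Q]_w ((expR (- gamma * t) ^+ 2)%:E * (Z w)%:E))%E.
  apply: eq_integral => w _; rewrite -EFinM; congr EFin.
  rewrite /Z mulrfctE /= !XE. ring.
have i2 : Q.-integrable setT (EFin \o (fun w => 2 * M * Y t w)).
  exact: integrableZl iY.
have i3 : Q.-integrable setT (EFin \o (fun w => Y t w * Y t w - 2 * M * Y t w)).
  by apply: (integrableB _ iYY i2).
have i4 : Q.-integrable setT (EFin \o (fun w : T => M ^+ 2)).
  by apply: (@bounded_integrable _ _ _ _ _ `|M ^+ 2|).
have i5 : Q.-integrable setT (EFin \o Z).
  by apply: (integrableD _ i3 i4).
rewrite integralZl// -[X in (_ * X)%E]fineK; last exact: integrable_fin_num i5.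
rewrite -EFinM; congr EFin.
rewrite [fine _](RintegralD measurableT i3 i4) RintegralB// RintegralZl//.
rewrite Rintegral_probability_cst mean_scaled_square// -/M.
rewrite /M mean_scaled// growthE /ou_v.
have gl0 : gamma + 2 * lambda != 0 by rewrite gt_eqF// addr_gt0// mulr_gt0.
have g0 : gamma != 0 by rewrite gt_eqF.
have E0 : expR (2 * gamma * t) != 0 by rewrite gt_eqF// expR_gt0.
have -> : expR (- gamma * t) ^+ 2 = (expR (2 * gamma * t))^-1.
  by rewrite expr2 -expRD -expRN; congr expR; ring.
have -> : expR (- 2 * gamma * t) = (expR (2 * gamma * t))^-1.
  by rewrite -expRN; congr expR; ring.
have si : (state_sign i : R) ^+ 2 = 1.
  by rewrite -real_normK ?num_real// normr_state_sign expr1n.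
case: eqVneq => [gE|gl].
  have lE : lambda = gamma / 2 by lra.
  by rewrite lE; field: si; rewrite E0 g0 gt_eqF// addr_gt0.
have dl0 : gamma - 2 * lambda != 0 by rewrite subr_eq0.
have -> : expR (2 * (gamma - 2 * lambda) * t) = expR ((gamma - 2 * lambda) * t) ^+ 2.
  by rewrite expr2 -expRD; congr expR; ring.
by field: si; rewrite g0 gl0 dl0 E0.
Qed.

End moments.

Unset Implicit Arguments.
Set Strict Implicit.

Theorem mainTheorem5 (R : realType) (d : measure_display)
    (T : measurableType d) (P : probability T R)
    (eps : R -> {RV P >-> bool}) (X : R -> {RV P >-> R})
    (a lambda gamma x : R)
    (a_gt0 : 0 < a) (lambda_gt0 : 0 < lambda) (gamma_gt0 : 0 < gamma)
    (eps_markov : two_state_markov eps (fun=> lambda))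
    (X_ou : ou_bounded_variation eps
              (fun i => if i then - a else a) (fun=> gamma) x X)
    (t : R) (t_ge0 : 0 <= t) :
  let P_ i : probability T R :=
    cond_probability P (measurable_state_at eps 0 i) in
  [/\ (0 < P (state_at eps 0 false))%E ->
        ('E_(P_ false)[X t] =
           (x * expR (- gamma * t) + a * ou_m lambda gamma t)%:E)%E,
      (0 < P (state_at eps 0 true))%E ->
        ('E_(P_ true)[X t] =
           (x * expR (- gamma * t) - a * ou_m lambda gamma t)%:E)%E
    & forall i : bool, (0 < P (state_at eps 0 i))%E ->
        ('V_(P_ i)[X t] = (a ^+ 2 * ou_v lambda gamma t)%:E)%E].
Proof.
move=> P_; split=> [P0|P1|i Pi].
- rewrite (expectation_ou a_gt0 gamma_gt0 eps_markov X_ou P0 t_ge0).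
  by rewrite /state_sign/= mulr1.
- rewrite (expectation_ou a_gt0 gamma_gt0 eps_markov X_ou P1 t_ge0).
  by rewrite /state_sign/= mulrN1 [- a * _]mulNr.
- exact: (variance_ou a_gt0 lambda_gt0 gamma_gt0 eps_markov X_ou Pi t_ge0).
Qed.
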